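(* Let $G$ be a finite, undirected, simple, connected graph. Then the following are equivalent: (i) $G \in \mathbf{WTW}/\mathbf{m_3}$; (ii) $G \in \mathbf{TW}/\mathbf{m_3}$; (iii) $G$ is HHD-free. That is, $\mathbf{WTW}/\mathbf{m_3}=\mathbf{TW}/\mathbf{m_3}=\text{HHD-free}$.
   Context: All graphs are finite, undirected, simple and connected. A $uv$-walk is a sequence of (not necessarily distinct) vertices $W: u=v_0,v_1,\ldots,v_n=v$ with $v_{i-1}$ adjacent to $v_i$ for all $i\in\{1,\ldots,n\}$; $v_1,\ldots,v_{n-1}$ are its internal vertices and $n$ is its length. A $uv$-path is a $uv$-walk with distinct vertices. A $uv$-induced path is a $uv$-path in which two vertices are adjacent in $G$ if and only if they are consecutive on the path. For non-adjacent vertices $u,v$: - $\mathbf{m_3}(u,v)$ is the set of $uv$-$m_3$ paths, i.e. $uv$-induced paths of length at least three. - $\mathbf{WTW}(u,v)$ is the set of $uv$-weakly toll walks: $uv$-walks $u,v_1,\ldots,v_{k-1},v$ such that, among the vertices of the walk, $u$ is adjacent only to the vertex $v_1$ and $v$ is adjacent only to the vertex $v_{k-1}$ (the vertices $v_1$ and $v_{k-1}$ may be repeated in the walk). - $\mathbf{TW}(u,v)$ is the set of $uv$-toll walks: $uv$-walks $u,v_1,\ldots,v_{k-1},v$ such that, among the vertices of the walk, $u$ is adjacent only to $v_1$ and $v$ is adjacent only to $v_{k-1}$, and moreover $\{v_1\}\cap\{v_2,\ldots,v_{k-1}\}=\emptyset$ and $\{v_{k-1}\}\cap\{v_1,\ldots,v_{k-2}\}=\emptyset$.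 Domination: for non-adjacent $u,v$, a $uv$-walk $W$ dominates a $uv$-walk $W'$ if every internal vertex of $W'$ is adjacent to some internal vertex of $W$ or belongs to $W$. The class $\mathbf{A}/\mathbf{B}$ consists of all graphs $G$ such that for every pair of non-adjacent vertices $u,v$ of $G$, every walk $W\in\mathbf{A}(u,v)$ dominates every walk $W'\in\mathbf{B}(u,v)$ (vacuously true if one of the sets is empty). A hole is a chordless cycle with at least five vertices. A house is the complement of an induced path with five vertices. A domino is the graph obtained from the chordless cycle $x_0,x_1,\ldots,x_5$ by adding the chord $x_1x_4$. A graph is HHD-free if it contains no house, no hole and no domino as an induced subgraph. *)

(* Defs.v *)
From mathcomp Require Import all_boot.

Set Implicit Arguments.
Unset Strict Implicit.
Unset Printing Implicit Defensive.

(* Graphs are irreflexive symmetric relations e on a finType.  Walks are only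
   considered between distinct vertices u and v, so they have length at least
   one; the walk u, v_1, ..., v_(k-1), v is encoded by the sequence
   s = [:: v_1; ...; v_(k-1)] of its internal vertices. *)

Section Graphs.

Variables (T : finType) (e : rel T).
Implicit Types (u v x y : T) (s : seq T).

Definition simple_graph : Prop := symmetric e /\ irreflexive e.

Definition connected_graph : Prop := forall x y, connect e x y.

Definition walk_vertices u v s : seq T := u :: rcons s v.

Definition walk_length s : nat := (size s).+1.

Definition is_walk u v s : Prop := path e u (rcons s v).

Definition is_path u v s : Prop := is_walk u v s /\ uniq (walk_vertices u v s).

Definition consecutive (i j : nat) : bool := (i.+1 == j) || (j.+1 == i).

Definition induced_path u v s : Prop :=
  is_path u v s /\
  forall i j : nat,
    i < size (walk_vertices u v s) -> j < size (walk_vertices u v s) ->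
    e (nth u (walk_vertices u v s) i) (nth u (walk_vertices u v s) j)
      = consecutive i j.

Definition m3_path u v s : Prop := induced_path u v s /\ 3 <= walk_length s.

(* The defaults of head and last are never used when u and v are not adjacent,
   since s is then nonempty. *)
Definition weakly_toll_walk u v s : Prop :=
  [/\ is_walk u v s,
      forall x, x \in walk_vertices u v s -> e u x -> x = head u s
    & forall x, x \in walk_vertices u v s -> e v x -> x = last v s].

Definition toll_walk u v s : Prop :=
  [/\ weakly_toll_walk u v s,
      head u s \notin behead s
    & last v s \notin take (size s).-1 s].

Definition dominates u v s s' : Prop :=
  forall x, x \in s' ->
    (exists2 y, y \in s & e x y) \/ x \in walk_vertices u v s.

(* Membership of the graph e in the class A/B. *)
Definition domination_class (A B : T -> T -> seq T -> Prop) : Prop :=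
  forall u v, u != v -> ~~ e u v ->
  forall s s', A u v s -> B u v s' -> dominates u v s s'.

Definition has_induced (S : finType) (h : rel S) : Prop :=
  exists2 f : S -> T, injective f & forall i j, e (f i) (f j) = h i j.

End Graphs.

Definition path_rel n : rel 'I_n := fun i j => consecutive i j.

Definition cycle_rel n : rel 'I_n :=
  fun i j => (i.+1 %% n == j) || (j.+1 %% n == i).

Definition compl_rel (S : finType) (h : rel S) : rel S :=
  fun i j => (i != j) && ~~ h i j.

Definition house : rel 'I_5 := compl_rel (@path_rel 5).

Definition domino : rel 'I_6 := fun i j =>
  [|| cycle_rel i j,
      (i == 1 :> nat) && (j == 4 :> nat)
    | (i == 4 :> nat) && (j == 1 :> nat)].

Definition HHD_free (T : finType) (e : rel T) : Prop :=
  [/\ ~ has_induced e house,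
      forall n, 5 <= n -> ~ has_induced e (@cycle_rel n)
    & ~ has_induced e domino].

(* Main.v *)
(* An HHD-free graph satisfies more than (i): for every walk W from u to v,
   with set C of internal vertices, every vertex of an m3 path P from u to v
   has a neighbour in C.  Otherwise take a maximal run of vertices of P without
   neighbours in C; a geodesic through C joining the two vertices of P that
   surround the run closes an induced cycle, so, holes being excluded, the run
   is a single vertex x whose neighbours y, z on P have a common neighbour in C.
   As P has length at least three, it contains a vertex w <> x adjacent to
   exactly one of y and z, and the union S of C and P minus {x, y, z} is
   connected and contains no neighbour of x.  A geodesic in S from the common
   neighbours of y and z to the neighbours of exactly one of them yields,
   according to its length, a house, a domino or a hole.
   Conversely, TW/m3 is closed under induced subgraphs and contains neither the
   house, nor the holes, nor the domino. *)
Require Import Defs.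
From mathcomp Require Import all_boot zify.

Set Implicit Arguments.
Unset Strict Implicit.
Unset Printing Implicit Defensive.

(** * Adjacency in cycles, and twin-freeness of the forbidden graphs *)

Lemma cycle_relE n (i j : 'I_n) : 2 < n ->
  cycle_rel i j =
    [|| consecutive i j, (i == 0 :> nat) && (j == n.-1 :> nat)
      | (j == 0 :> nat) && (i == n.-1 :> nat)].
Proof.
move=> n_gt2; rewrite /cycle_rel /consecutive.
have modS (k : 'I_n) : k.+1 %% n = if k == n.-1 :> nat then 0 else k.+1.
  case: eqP => [->|neq]; first by rewrite prednK ?modnn //; lia.
  by apply: modn_small; have := ltn_ord k; lia.
rewrite !modS; move: (ltn_ord i) (ltn_ord j).
by case: (eqVneq (i : nat) n.-1); case: (eqVneq (j : nat) n.-1); lia.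
Qed.

(* A map inducing a twin-free graph is automatically injective. *)
Definition twin_free (S : finType) (h : rel S) : Prop :=
  forall i j, (forall k, h i k = h j k) -> i = j.

Lemma house_twin_free : twin_free house.
Proof.
move=> i j tw; apply/eqP.
have := (tw (@Ordinal 5 0 isT), tw (@Ordinal 5 1 isT), tw (@Ordinal 5 2 isT),
         tw (@Ordinal 5 3 isT), tw (@Ordinal 5 4 isT)).
by case: i j {tw} => [[|[|[|[|[|i]]]]] Hi] [[|[|[|[|[|j]]]]] Hj] // [[[[]]]].
Qed.

Lemma domino_twin_free : twin_free domino.
Proof.
move=> i j tw; apply/eqP.
have := (tw (@Ordinal 6 0 isT), tw (@Ordinal 6 1 isT), tw (@Ordinal 6 2 isT),
         tw (@Ordinal 6 3 isT), tw (@Ordinal 6 4 isT), tw (@Ordinal 6 5 isT)).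
by case: i j {tw} => [[|[|[|[|[|[|i]]]]]] Hi] [[|[|[|[|[|[|j]]]]]] Hj] // [[[[[]]]]].
Qed.

(** The two neighbours of [i] have only [i] as a common neighbour: a second one would close a cycle
    of length four. *)
Lemma cycle_twin_free n : 4 < n -> twin_free (@cycle_rel n).
Proof.
move=> n_gt4 i j tw; apply/val_inj => /=.
have lt_in := ltn_ord i; have lt_jn := ltn_ord j.
pose next := if i == n.-1 :> nat then 0 else i.+1.
pose prev := if i == 0 :> nat then n.-1 else i.-1.
have lt_next : next < n by rewrite /next; case: eqP; lia.
have lt_prev : prev < n by rewrite /prev; case: eqP; lia.
have : cycle_rel j (Ordinal lt_next).
  by rewrite -tw cycle_relE /next /consecutive /=; [case: (eqVneq (i : nat) n.-1)|]; lia.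
have : cycle_rel j (Ordinal lt_prev).
  by rewrite -tw cycle_relE /prev /consecutive /=; [case: (eqVneq (i : nat) 0)|]; lia.
rewrite !cycle_relE /consecutive /=; try lia.
rewrite /next /prev.
by case: (eqVneq (i : nat) n.-1); case: (eqVneq (i : nat) 0); lia.
Qed.

(** * Domination of m3 paths in HHD-free graphs *)

Section Graph.

Variables (T : finType) (e : rel T).
Hypotheses (e_sym : symmetric e) (e_irr : irreflexive e).

Definition within (S : pred T) : rel T := [rel a b | [&& S a, S b & e a b]].

(** The adjacency pattern of an induced path with [m] edges; when a cycle is built, distinctness is
    recovered from twin-freeness. *)
Definition chordless (r : nat -> T) (m : nat) : Prop :=
  forall i j, i <= m -> j <= m -> e (r i) (r j) = consecutive i j.

Lemma twin_free_induced (S : finType) (h : rel S) (f : S -> T) :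
  twin_free h -> (forall i j, e (f i) (f j) = h i j) -> has_induced e h.
Proof.
move=> tf fE; exists f => // i j eq_f.
by apply: tf => k; rewrite -!fE eq_f.
Qed.

(* [r 0, ..., r m] is a shortest walk inside S from A to B. *)
Lemma geodesic (A B S : pred T) c w :
  A c -> B w -> S c -> connect (within S) c w ->
  exists r m, [/\ A (r 0), B (r m), forall i, i <= m -> S (r i), chordless r m
    & (forall i, 0 < i <= m -> ~~ A (r i)) /\ (forall i, i < m -> ~~ B (r i))].
Proof.
move=> Ac Bw Sc /connectP [s s_path w_last].
pose walk (r : nat -> T) m := [/\ A (r 0), B (r m), forall i, i <= m -> S (r i)
  & forall i, i < m -> e (r i) (r i.+1)].
have [m [r]] : exists m r, walk r m.
  exists (size s), (nth c (c :: s)); split=> //.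
  - by rewrite nth_last /= -w_last.
  - case=> [|i] //= lt_is; have /(_ i lt_is) := (pathP c s_path).
    by case/and3P.
  - by move=> i lt_is; case/(pathP c)/(_ i lt_is)/and3P: s_path.
(* Descent on the length: a later vertex in [A], an earlier one in [B], or a chord each gives a
   shorter walk. *)
elim/ltn_ind: m r => m IHm r [A0 Bm Sr er].
case: (boolP [exists i : 'I_m.+1, (0 < i) && A (r i)]).
  case/existsP=> i /andP[i_gt0 Ai]; apply: (IHm (m - i) _ (fun k => r (k + i))).
    by have := ltn_ord i; lia.
  split=> [||k le_k|k lt_k]; first exact: Ai.
  - by rewrite subnK // -ltnS.
  - by apply: Sr; have := ltn_ord i; lia.
  - by apply: er; lia.
move/existsPn=> nA.
case: (boolP [exists i : 'I_m, B (r i)]).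
  case/existsP=> i Bi; apply: (IHm i (ltn_ord i) r).
  split=> // k lt_k; [apply: Sr | apply: er]; have := ltn_ord i; lia.
move/existsPn=> nB.
case: (boolP [exists i : 'I_m.+1, [exists j : 'I_m.+1, (i.+1 < j) && e (r i) (r j)]]).
  case/existsP=> i /existsP[j /andP[lt_ij e_ij]].
  have lt_jm := ltn_ord j.
  (* The shortcut goes from [r i] straight to [r j], omitting the [j - i.+1] vertices between
     them. *)
  apply: (IHm (m - (j - i.+1)) _ (fun k => if k <= i then r k else r (k + (j - i.+1)))).
    by lia.
  split=> //=.
  - by rewrite ifF ?subnK //; lia.
  - by move=> k le_k; case: ifP => _; apply: Sr; lia.
  - move=> k lt_k; case: (ltngtP k i) => [lt_ki|lt_ik|->].
    + by apply: er; lia.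
    + by rewrite addSn; apply: er; lia.
    + by have -> : i.+1 + (j - i.+1) = j by lia.
move/existsPn=> nC.
exists r, m; split=> //.
  have ch i j : i < j -> j <= m -> e (r i) (r j) = consecutive i j.
    move=> lt_ij le_jm; case: (eqVneq i.+1 j) => [<-|ne_ij].
      by rewrite er /consecutive ?eqxx //; lia.
    have lt_i : i < m.+1 by lia. 
    have /existsPn/(_ (Ordinal (le_jm : j < m.+1))) := nC (Ordinal lt_i).
    by rewrite /= /consecutive negb_and => /orP[|/negPf->]; lia.
  move=> i j le_im le_jm; case: (ltngtP i j) => [lt_ij|lt_ji|->].
  - exact: ch.
  - by rewrite e_sym ch // /consecutive orbC.
  - by rewrite e_irr /consecutive; lia.
split=> [i /andP[i_gt0 le_im]|i lt_im].
  by have := nA (Ordinal (le_im : i < m.+1)); rewrite /= i_gt0.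
exact: (nB (Ordinal lt_im)).
Qed.

(** Following [p] and then [q] closes a cycle on [l.+1 + m.+1] vertices; [2 < l + m] makes these at
    least five, so [cycle_twin_free] applies. *)
Lemma glue_cycle (p q : nat -> T) l m :
  2 < l + m -> chordless p l -> chordless q m ->
  (forall i j, i <= l -> j <= m ->
     e (p i) (q j) = (i == l) && (j == 0) || (i == 0) && (j == m)) ->
  has_induced e (@cycle_rel (l + m).+2).
Proof.
move=> lm pC qC pq.
pose f (i : 'I_(l + m).+2) := if i <= l then p i else q (i - l.+1).
apply: (twin_free_induced (f := f)); first by apply: cycle_twin_free; lia.
move=> i j; rewrite cycle_relE /f; last by lia.
have lt_i := ltn_ord i; have lt_j := ltn_ord j.
case: leqP => le_il; case: leqP => le_jl.
- by rewrite pC // /consecutive /=; lia.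
- by rewrite pq ?/consecutive /=; lia.
- by rewrite e_sym pq ?/consecutive /=; lia.
- by rewrite qC ?/consecutive /=; lia.
Qed.

(** The inner vertices of the geodesic see neither [y] nor [z], and none of its vertices sees [x],
    so its length alone decides which forbidden graph appears. *)
Lemma square_extension (S : pred T) x y z c w :
    HHD_free e -> e x y -> e x z -> ~~ e y z -> (forall t, S t -> ~~ e x t) ->
    S c -> e y c -> e z c -> e y w (+) e z w -> ~ connect (within S) c w.
Proof.
move=> [no_house no_hole no_domino] xy xz yz xS Sc yc zc yzw cw.
have [||//||] :=
  @geodesic (fun t => e y t && e z t) (fun t => e y t (+) e z t) S c w => //.
  by rewrite yc zc.
move=> r [m [/andP[y0 z0] yzm Sr rC [nA nB]]].
wlog [zm ym] : y z xy xz yz {yc zc yzw} y0 z0 yzm nA nB / e z (r m) /\ ~~ e y (r m).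
  move=> wl; have := yzm; case ym: (e y (r m)); case zm: (e z (r m)) => // _.
    apply: (wl z y) => //; rewrite ?[e z y]e_sym ?zm ?ym //.
    - by move=> i /nA; rewrite andbC.
    - by move=> i /nB; rewrite addbC.
  by apply: (wl y z) => //; rewrite ?zm ?ym.
have m_gt0 : 0 < m by case: m ym {yzm Sr rC nA nB zm} => //; rewrite y0.
have mid i : 0 < i < m -> (e y (r i) = false) * (e z (r i) = false).
  move=> /andP[i_gt0 lt_im]; have := nA i; have := nB i lt_im.
  rewrite i_gt0 ltnW //= => + /(_ isT).
  by case: (e y _); case: (e z _).
have xr i : i <= m -> e x (r i) = false by move=> /Sr/xS/negPf.
have [m1|m_ge2] := leqP m 1.
  have {m1 m_gt0} m1 : m = 1 by lia.
  (* The square x y (r 0) z with roof r 1 over the edge between z and r 0. *)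
  subst m; apply: no_house.
  (* Successive entries are non-adjacent: the list is the induced path of the complement. *)
  pose f (i : 'I_5) := nth x [:: z; y; r 1; x; r 0] i.
  apply: (twin_free_induced (f := f)); first exact: house_twin_free.
  have r01 : e (r 0) (r 1) by rewrite rC.
  by case=> [[|[|[|[|[|i]]]]] Hi] [[|[|[|[|[|j]]]]] Hj] //;
   rewrite /f /house /compl_rel /path_rel /consecutive /= ?e_irr //;
   rewrite ?(negPf ym, negPf yz, y0, z0, zm, xy, xz, r01, xr) //;
   rewrite e_sym ?(negPf ym, negPf yz, y0, z0, zm, xy, xz, r01, xr).
have [m2|m_ge3] := leqP m 2.
  have {m2 m_gt0 m_ge2} m2 : m = 2 by lia.
  (* The squares x z (r 0) y and z (r 0) (r 1) (r 2). *)
  subst m; apply: no_domino.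
  pose f (i : 'I_6) := nth x [:: x; z; r 2; r 1; r 0; y] i.
  apply: (twin_free_induced (f := f)); first exact: domino_twin_free.
  have r01 : e (r 0) (r 1) by rewrite rC.
  have r12 : e (r 1) (r 2) by rewrite rC.
  have r02 : e (r 0) (r 2) = false by rewrite rC.
  have [y1 z1] := mid 1 isT.
  by case=> [[|[|[|[|[|[|i]]]]]] Hi] [[|[|[|[|[|[|j]]]]]] Hj] //;
   rewrite /f /domino /cycle_rel /= ?e_irr //;
   rewrite ?(negPf ym, negPf yz, y0, z0, zm, xy, xz, r01, r12, r02, y1, z1, xr) //;
   rewrite e_sym ?(negPf ym, negPf yz, y0, z0, zm, xy, xz, r01, r12, r02, y1, z1, xr).
(* The single vertex [z], as a path without edges, closes the geodesic into a hole; [m] is at least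
   three here. *)
apply: (no_hole (0 + m).+2) => //.
apply: (@glue_cycle (fun=> z) r 0 m) => //.
  by move=> i j; rewrite !leqn0 => /eqP-> /eqP->; rewrite e_irr.
move=> i j; rewrite leqn0 => /eqP-> le_jm /=.
case: (posnP j) => [->|j_gt0] //=.
by case: eqP => [->//|ne_jm]; rewrite mid // j_gt0; lia.
Qed.

(** Lying in [C] is not enough: a neighbour in [C] is required. *)
Definition touches (C : pred T) t := [exists c, C c && e t c].

(** Between the nearest touching indices [a < i < b], no vertex of [p] sees [C], so this stretch and
    a geodesic in [C] can be glued into a cycle. *)
Lemma untouched_square (C : pred T) (p : nat -> T) k i :
    (forall n, 4 < n -> ~ has_induced e (@cycle_rel n)) ->
    {in C &, forall c d, connect (within C) c d} ->
    chordless p k -> touches C (p 0) -> touches C (p k) ->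
    i <= k -> ~~ touches C (p i) ->
  exists a c, [/\ i = a.+1, a.+2 <= k, C c, e (p a) c & e (p a.+2) c].
Proof.
move=> no_hole C_conn pC t0 tk le_ik nti.
have exa : exists a, (a <= i) && touches C (p a) by exists 0.
have bda a : (a <= i) && touches C (p a) -> a <= i by case/andP.
have [a /andP[le_ai ta] maxa] := ex_maxnP exa bda.
have exb : exists b, [&& i <= b, b <= k & touches C (p b)].
  by exists k; rewrite le_ik leqnn.
have [b /and3P[le_ib le_bk tb] minb] := ex_minnP exb.
have lt_ai : a < i by rewrite ltn_neqAle le_ai andbT; apply: contraNneq nti => <-.
have lt_ib : i < b by rewrite ltn_neqAle le_ib andbT; apply: contraNneq nti => ->.
have between j c : a < j -> j < b -> C c -> e (p j) c = false.
  move=> lt_aj lt_jb Cc; apply/negbTE/negP => e_jc.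
  have tj : touches C (p j) by apply/existsP; exists c; rewrite Cc.
  case: (leqP j i) => [le_ji|lt_ij].
    by have := maxa j; rewrite le_ji tj leqNgt lt_aj => /(_ isT).
  have le_jk : j <= k by apply: leq_trans le_bk; apply: ltnW.
  by have := minb j; rewrite tj (ltnW lt_ij) le_jk leqNgt lt_jb => /(_ isT).
case/existsP: tb => c /andP[Cc e_bc]; case/existsP: ta => d /andP[Cd e_ad].
(* The geodesic leaves from the side of [p b], the orientation required by [glue_cycle]. *)
have [r [m [e_br e_ar Cr rC [nbr nar]]]] :=
  geodesic e_bc e_ad Cc (C_conn c d Cc Cd).
have [l [l_gt1 bE]] : exists l, 1 < l /\ b = a + l.
  by exists (b - a); clear -lt_ai lt_ib; lia.
subst b.
have [lm_gt2|lm_le2] := ltnP 2 (l + m).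
  exfalso; apply: (no_hole (l + m).+2); first by clear -lm_gt2; lia.
  apply: (@glue_cycle (fun j => p (a + j)) r) => //.
    move=> j j' le_j le_j'; rewrite pC.
    - by rewrite /consecutive -!addnS !eqn_add2l.
    - by clear -le_j le_bk; lia.
    - by clear -le_j' le_bk; lia.
  move=> j j' le_j le_j'.
  have [->|j_gt0] := posnP j.
    rewrite addn0 (ltn_eqF (ltnW l_gt1)) /=.
    have [->//|ne_j'] := eqVneq j' m.
    by apply/negbTE/nar; rewrite ltn_neqAle ne_j'.
  have [->|ne_j] /= := eqVneq j l.
    rewrite orbF; have [->//|j'_gt0] := posnP j'.
    by apply/negbTE/nbr; rewrite j'_gt0.
  apply: between; last exact: Cr.
    by clear -j_gt0; lia.
  by clear -ne_j le_j; lia.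
have [m0 l2 iE] : [/\ m = 0, l = 2 & i = a.+1].
  by clear -l_gt1 lm_le2 lt_ai lt_ib; split; lia.
subst m l i; rewrite addn2 in le_bk e_br.
by exists a, (r 0); split=> //; apply: Cr.
Qed.

(** A missed vertex is the corner [x] of a square as in [square_extension], with [y] and [z] its
    neighbours on [p]; [2 < k] provides the vertex that tells [y] from [z]. *)
Lemma HHD_free_touches (C : pred T) (p : nat -> T) k :
    HHD_free e -> {in C &, forall c d, connect (within C) c d} ->
    2 < k -> chordless p k -> touches C (p 0) -> touches C (p k) ->
  forall i, i <= k -> touches C (p i).
Proof.
move=> hhd C_conn k_gt2 pC t0 tk i le_ik; apply: contraT => nti.
have [_ no_hole _] := hhd.
have [a [c [iE le_ak Cc e_ac e_a2c]]] :=
  untouched_square no_hole C_conn pC t0 tk le_ik nti.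
(* These are the indices on [p] other than those of the missed vertex and its two neighbours. *)
pose far j := (j < a) || (a.+2 < j).
pose S t := C t || [exists j : 'I_k.+1, far j && (p j == t)].
have Sp j : j <= k -> far j -> S (p j).
  move=> le_jk jP; apply/orP; right; apply/existsP.
  by exists (Ordinal (le_jk : j < k.+1)); rewrite jP /=.
have S_sym : connect_sym (within S).
  by apply: sym_connect_sym => s t; rewrite /within /= e_sym andbCA.
have CS t : C t -> S t by rewrite /S => ->.
have sub_CS : subrel (connect (within C)) (connect (within S)).
  apply: connect_sub => s t /and3P[Cs Ct e_st]; apply: connect1.
  by rewrite /within /= !CS.
have touch_conn t : touches C t -> S t -> connect (within S) c t.
  case/existsP=> t' /andP[Ct' e_tt'] St.
  apply: connect_trans (sub_CS _ _ (C_conn _ _ Cc Ct')) _.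
  by apply: connect1; rewrite /within /= St CS // e_sym.
have step j : j < k -> far j -> far j.+1 -> connect (within S) (p j) (p j.+1).
  move=> lt_jk far_j far_j1; apply: connect1.
  rewrite /within /= !Sp ?pC ?(ltnW lt_jk) //.
  by rewrite /consecutive eqxx.
(* Each remaining piece of [p] hangs on [C] by its outer end, [p 0] or [p k], and the induction
   moves inwards from there. *)
have left_conn j : j < a -> connect (within S) c (p j).
  elim: j => [|j IHj] lt_ja; first by apply/touch_conn/Sp; rewrite // /far lt_ja.
  apply: connect_trans (IHj (ltnW lt_ja)) _.
  by apply: step; rewrite /far; clear -lt_ja le_ak; lia.
have right_conn d : a.+2 < k - d -> connect (within S) c (p (k - d)).
  elim: d => [|d IHd] lt_ad.
    by rewrite subn0 in lt_ad *; apply/touch_conn/Sp; rewrite // /far lt_ad orbT.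
  have lt_ad1 : a.+2 < k - d by clear -lt_ad; lia.
  apply: connect_trans (IHd lt_ad1) _; rewrite S_sym.
  have -> : k - d = (k - d.+1).+1 by clear -lt_ad; lia.
  by apply: step; rewrite /far; clear -lt_ad; lia.
(* The vertex just before [p a] serves if there is one; otherwise [a = 0] and [p 3] exists. *)
have [w le_wk w_near] : exists2 w, w <= k & (w.+1 == a) || (w == a.+3).
  case: (posnP a) => [->|a_gt0]; first by exists 3.
  by exists a.-1; clear -a_gt0 le_ak; lia.
have conn_w : connect (within S) c (p w).
  case/orP: w_near => /eqP wE; first by apply: left_conn; rewrite -wE.
  by rewrite -(subKn le_wk); apply: right_conn; rewrite subKn // wE.
exfalso; move: conn_w; rewrite iE in nti le_ik.
apply: (@square_extension S (p a.+1) (p a) (p a.+2)); rewrite // ?pC //.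
- by rewrite /consecutive eqxx orbT.
- exact: ltnW.
- by rewrite /consecutive eqxx.
- by rewrite /consecutive; clear; lia.
- by rewrite ltnW // ltnW.
- move=> t /orP[Ct|/existsP[j /andP[far_j /eqP<-]]].
    by apply: contraNN nti => e_t; apply/existsP; exists t; rewrite Ct.
  rewrite pC // -1?ltnS // /consecutive.
  by move: far_j; rewrite /far; clear; lia.
- exact: CS.
- by rewrite /consecutive; case/orP: w_near => /eqP wE; clear -wE; lia.
- by rewrite ltnW // ltnW.
Qed.

(** The internal vertices of the walk form a connected set, touched by [u] and [v] through its first
    and last members. *)
Lemma HHD_free_walk_dominates u v s s' :
  HHD_free e -> ~~ e u v -> is_walk e u v s -> m3_path e u v s' ->
  dominates e u v s s'.
Proof.
rewrite /is_walk rcons_path => hhd nuv /andP[s_path last_v] [[_ s'C] s'_len] x xs'.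
case: (boolP (x \in s)) => [xs|nxs]; first by right; rewrite inE mem_rcons inE xs !orbT.
(* Without internal vertices the walk would be an edge from [u] to [v]. *)
left; case: s s_path last_v nxs => [|h s] /=; first by move=> _ huv; rewrite huv in nuv.
case/andP=> uh s_path last_v nxs.
have within_s : path (within (mem (h :: s))) h s.
  apply: (sub_in_path (P := mem (h :: s)) (e := e)) => //; last exact/allP.
  by move=> a b Pa Pb eab; apply/and3P.
have s_conn : {in mem (h :: s) &, forall c d, connect (within (mem (h :: s))) c d}.
  have h_conn c : c \in h :: s -> connect (within (mem (h :: s))) h c.
    exact: path_connect.
  move=> c d cs ds; apply: connect_trans (h_conn d ds).
  rewrite (sym_connect_sym _) ?h_conn // => a b.
  by rewrite /within /= e_sym andbCA.
pose p i := nth u (walk_vertices u v s') i.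
have size_w : size (walk_vertices u v s') = (size s').+2 by rewrite /= size_rcons.
have pC : chordless p (size s').+1.
  by move=> i j le_i le_j; apply: s'C; rewrite size_w.
(* Index 0 belongs to [u], whence the shift by one. *)
have xE : p (index x s').+1 = x by rewrite /p /= nth_rcons index_mem xs' nth_index.
have := @HHD_free_touches (mem (h :: s)) p (size s').+1 hhd s_conn s'_len pC
  _ _ (index x s').+1 _.
rewrite xE => /(_ _ _ _)/existsP[] //.
- by apply/existsP; exists h; apply/andP; split; first exact: mem_head.
- apply/existsP; exists (last h s); apply/andP; split; first exact: mem_last.
  by rewrite /p /= nth_rcons ltnn eqxx e_sym.
- by rewrite ltnS index_size.
- by move=> y /andP[ys exy]; exists y.
Qed.

End Graph.

(** * Passage to induced subgraphs *)

Section Hereditary.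

Variables (S T : finType) (h : rel S) (e : rel T) (f : S -> T).
Hypotheses (f_inj : injective f) (fE : forall i j, e (f i) (f j) = h i j).

Lemma walk_vertices_map u v s :
  walk_vertices (f u) (f v) (map f s) = map f (walk_vertices u v s).
Proof. by rewrite /walk_vertices -map_rcons. Qed.

Lemma is_walk_map u v s : is_walk h u v s -> is_walk e (f u) (f v) (map f s).
Proof.
rewrite /is_walk -map_rcons path_map; apply: sub_path => i j.
by rewrite /= fE.
Qed.

Lemma toll_walk_map u v s :
  toll_walk h u v s -> toll_walk e (f u) (f v) (map f s).
Proof.
case=> [[ws us vs] h1 l1]; split.
- split; first exact: is_walk_map.
  + move=> x; rewrite walk_vertices_map => /mapP[i is_ ->]; rewrite fE => /us->//.
    by case: (s).
  + move=> x; rewrite walk_vertices_map => /mapP[i is_ ->]; rewrite fE => /vs->//.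
    by rewrite last_map.
- by case: s {ws us vs l1} h1 => //= a s; rewrite mem_map.
- by rewrite last_map size_map -map_take mem_map.
Qed.

Lemma m3_path_map u v s : m3_path h u v s -> m3_path e (f u) (f v) (map f s).
Proof.
case=> [[[ws us] si] len]; split; last by rewrite /walk_length size_map.
split; first by split; [exact: is_walk_map | rewrite walk_vertices_map map_inj_uniq].
move=> i j; rewrite walk_vertices_map size_map => lt_i lt_j.
by rewrite !(nth_map u) // fE si.
Qed.

Lemma dominates_map u v s s' :
  dominates e (f u) (f v) (map f s) (map f s') -> dominates h u v s s'.
Proof.
move=> dom x xs; have [|[_ /mapP[y ys ->]]|] := dom (f x); first exact: map_f.
  by rewrite fE => hxy; left; exists y.
by rewrite walk_vertices_map mem_map //; right.
Qed.

(** Walks are pushed forward along the embedding and domination is pulled back: the dominating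
    neighbour lies on the image walk, hence in the copy. *)
Lemma toll_m3_hereditary :
  domination_class e (toll_walk e) (m3_path e) ->
  domination_class h (toll_walk h) (m3_path h).
Proof.
move=> dom u v neq nuv s s' /toll_walk_map ts /m3_path_map ms.
by apply: dominates_map; apply: dom ts ms; rewrite ?(inj_eq f_inj) ?fE.
Qed.

End Hereditary.

(** * The forbidden graphs lie outside TW/m3 *)

Lemma house_not_dominated :
  ~ domination_class house (toll_walk house) (m3_path house).
Proof.
pose o k (lt_k5 : k < 5) := Ordinal lt_k5.
(* The roof is 2, over the edge 04 of the square 0, 3, 1, 4; the vertex 3 is opposite to 4 in the
   square. *)
move=> /(_ (o 2 isT) (o 1 isT) isT isT [:: o 4 isT] [:: o 0 isT; o 3 isT]) dom.
have [||//|[y]|] := dom _ _ (o 3 isT).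
- by do 2 split=> //; case=> [[|[|[|[|[|i]]]]] Hi] // _ _; apply/val_inj.
- split=> //; split=> //.
  by case=> [|[|[|[|i]]]] [|[|[|[|j]]]].
- by rewrite !inE => /eqP->.
- by rewrite !inE.
Qed.

(** The two sides of the six-cycle between 0 and 3 are compared: 5 sees neither 1 nor 2. *)
Lemma domino_not_dominated :
  ~ domination_class domino (toll_walk domino) (m3_path domino).
Proof.
pose o k (lt_k6 : k < 6) := Ordinal lt_k6.
move=> /(_ (o 0 isT) (o 3 isT) isT isT [:: o 1 isT; o 2 isT] [:: o 5 isT; o 4 isT]) dom.
have [||//|[y]|] := dom _ _ (o 5 isT).
- by do 2 split=> //; case=> [[|[|[|[|[|[|i]]]]]] Hi] // _ _; apply/val_inj.
- split=> //; split=> //.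
  by case=> [|[|[|[|i]]]] [|[|[|[|j]]]].
- by rewrite !inE => /orP[]/eqP->.
- by rewrite !inE.
Qed.

(** For two vertices at distance two, the short way round is a toll walk and the long way an m3
    path; the middle vertex of the former misses 1 on the latter. *)
Lemma cycle_not_dominated n : 4 < n ->
  ~ domination_class (@cycle_rel n) (toll_walk (@cycle_rel n)) (m3_path (@cycle_rel n)).
Proof.
case: n => [|[|[|n]]] // n_gt1.
pose o k : 'I_n.+3 := inord k.
pose s' := map o (iota 1 n).
have oE k l : k < n.+3 -> l < n.+3 -> cycle_rel (o k) (o l) =
    [|| consecutive k l, (k == 0) && (l == n.+2) | (l == 0) && (k == n.+2)].
  by move=> lt_k lt_l; rewrite cycle_relE ?/consecutive ?inordK.
have neq_o k l : k < n.+3 -> l < n.+3 -> (o k == o l) = (k == l).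
  by move=> lt_k lt_l; rewrite -val_eqE /= !inordK.
have wE : walk_vertices (o 0) (o n.+1) s' = map o (iota 0 n.+2).
  rewrite /walk_vertices /s' -map_rcons -[RHS]/(o 0 :: map o (iota 1 n.+1)).
  by congr (_ :: map o _); rewrite -[RHS]/(iota 1 n.+1) -(addn1 n) iotaD cats1 addnC.
have indC i j : i < n.+2 -> j < n.+2 ->
    cycle_rel (nth (o 0) (walk_vertices (o 0) (o n.+1) s') i)
      (nth (o 0) (walk_vertices (o 0) (o n.+1) s') j) = consecutive i j.
  rewrite wE => lt_i lt_j.
  by rewrite !(nth_map 0) ?size_iota // !nth_iota // oE /consecutive;
    clear -lt_i lt_j; lia.
have s'_path : m3_path (@cycle_rel n.+3) (o 0) (o n.+1) s'.
  split; last by rewrite /walk_length size_map size_iota; clear -n_gt1; lia.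
  split; last by move=> i j; rewrite wE size_map size_iota -wE; apply: indC.
  split.
    apply/(pathP (o 0)) => i; rewrite size_rcons size_map size_iota => lt_i.
    have := indC i i.+1 (ltnW lt_i) lt_i; rewrite /consecutive eqxx.
    by rewrite /walk_vertices /= => ->.
  rewrite wE map_inj_in_uniq ?iota_uniq // => k l; rewrite !mem_iota.
  move=> /andP[_ lt_k] /andP[_ lt_l] /eqP.
  by rewrite neq_o ?(leqW lt_k) ?(leqW lt_l) // => /eqP.
have s_toll : toll_walk (@cycle_rel n.+3) (o 0) (o n.+1) [:: o n.+2].
  do 2 split=> //.
  - by rewrite /is_walk /= !oE // /consecutive; clear -n_gt1; lia.
  - move=> x; rewrite !inE => /or3P[]/eqP-> //; rewrite oE // /consecutive;
      clear -n_gt1; lia.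
  - move=> x; rewrite !inE => /or3P[]/eqP-> //; rewrite oE // /consecutive;
      clear -n_gt1; lia.
have neq_uv : o 0 != o n.+1 by rewrite neq_o.
have nadj_uv : ~~ cycle_rel (o 0) (o n.+1).
  by rewrite oE // /consecutive; clear -n_gt1; lia.
have o1_s' : o 1 \in s' by apply/map_f; rewrite mem_iota; clear -n_gt1; lia.
move=> /(_ _ _ neq_uv nadj_uv _ _ s_toll s'_path _ o1_s')[[y]|].
- by rewrite inE => /eqP->; rewrite oE // /consecutive; clear -n_gt1; lia.
- by rewrite !inE !neq_o //; clear -n_gt1; lia.
Qed.

Theorem corollary4 (T : finType) (e : rel T)
    (simple_e : simple_graph e) (connected_e : connected_graph e) :
  (domination_class e (weakly_toll_walk e) (m3_path e) <->
     domination_class e (toll_walk e) (m3_path e)) /\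
  (domination_class e (toll_walk e) (m3_path e) <-> HHD_free e).
Proof.
have [e_sym e_irr] := simple_e.
(* Three implications in a circle give both equivalences. *)
have wtw_tw : domination_class e (weakly_toll_walk e) (m3_path e) ->
    domination_class e (toll_walk e) (m3_path e).
  by move=> dom u v neq nuv s s' [ts _ _]; apply: dom.
have tw_hhd : domination_class e (toll_walk e) (m3_path e) -> HHD_free e.
  move=> dom; split=> [[f f_inj fE]|n n_gt4 [f f_inj fE]|[f f_inj fE]].
  - exact: house_not_dominated (toll_m3_hereditary f_inj fE dom).
  - exact: cycle_not_dominated n_gt4 (toll_m3_hereditary f_inj fE dom).
  - exact: domino_not_dominated (toll_m3_hereditary f_inj fE dom).
have hhd_wtw : HHD_free e -> domination_class e (weakly_toll_walk e) (m3_path e).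
  by move=> hhd u v _ nuv s s' [ws _ _]; apply: HHD_free_walk_dominates.
split; split=> //.
  by move/tw_hhd/hhd_wtw.
by move/hhd_wtw/wtw_tw.
Qed.
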